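(* Let $T \in \mathbb{Z}[z]$ be a polynomial of degree $m \geq 4$ with simple roots, none of which lies in $\{1,-1\}$, and suppose that $T$ is either a cyclotomic polynomial or a Salem polynomial. Then there exists a monic expansive polynomial $P(z) \in \mathbb{Z}[z]$ of degree $m$ such that $$(z-1)\,T(z) = z\,P(z) - P^{*}(z).$$
   Context: For a polynomial $P$ of degree $n$, its reciprocal polynomial is $P^{*}(z) = z^{n} P(1/z)$. $P$ is called reciprocal if $P^*=P$. An expansive polynomial is a polynomial with coefficients in a real subfield of $\mathbb{C}$, of degree $\geq 1$, all of whose complex roots have modulus strictly greater than $1$. ''Cyclotomic polynomial'' means (non-standardly) a monic polynomial with integer coefficients having all its roots on the unit circle, i.e. a product of $n$-th cyclotomic polynomials $\Phi_n$ for various values of $n$. A Salem polynomial is a monic reciprocal polynomial with integer coefficients having exactly one zero (of multiplicity $1$) of modulus $>1$, this zero being a real number $>1$, and having at least one zero on the unit circle. *)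

(* Defs.v *)
From mathcomp Require Import all_boot all_order all_algebra.
From mathcomp Require Import complex.
From mathcomp Require Import reals.
Set Implicit Arguments.
Unset Strict Implicit.
Unset Printing Implicit Defensive.
Import Order.TTheory GRing.Theory Num.Theory.
Local Open Scope ring_scope.
Local Open Scope complex_scope.

(* z^n P(1/z), where n = (size P).-1 is the degree of P; the exponent
   subtraction is never truncated since i < size P. *)
Definition reciprocal (A : nzRingType) (P : {poly A}) : {poly A} :=
  \sum_(i < size P) P`_i *: 'X^((size P).-1 - i).

Lemma horner_reciprocal (F : fieldType) (P : {poly F}) (z : F) :
  z != 0 -> (reciprocal P).[z] = z ^+ (size P).-1 * P.[z^-1].
Proof.
move=> z0; rewrite /reciprocal horner_sum horner_coef mulr_sumr.
apply: eq_bigr => i _; rewrite hornerZ hornerXn mulrCA; congr (_ * _).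
have le_i : (i <= (size P).-1)%N.
  by rewrite -ltnS (ltn_predK (ltn_ord i)).
by rewrite expfB_cond ?exprVn // (negPf z0).
Qed.

Definition is_reciprocal (A : nzRingType) (P : {poly A}) : Prop :=
  reciprocal P = P.


Definition toC (R : realType) (P : {poly int}) : {poly R[i]} := map_poly intr P.

(* Num.real is the real line inside R[i], the largest real subfield. *)
Definition expansive (R : realType) (P : {poly R[i]}) : Prop :=
  [/\ P \is a polyOver Num.real, (1 < size P)%N
    & forall z : R[i], root P z -> 1 < `|z|].

Definition simple_roots (R : realType) (P : {poly R[i]}) : Prop :=
  forall z : R[i], root P z -> mup z P = 1%N.

(* Nonstandard terminology: T need not be irreducible; by Kronecker's theorem it
   is a product of polynomials 'Phi_n. *)
Definition cyclotomic_poly (R : realType) (T : {poly int}) : Prop :=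
  T \is monic /\ forall z : R[i], root (toC R T) z -> `|z| = 1.

Definition salem_poly (R : realType) (T : {poly int}) : Prop :=
  [/\ T \is monic,
      is_reciprocal T,
      exists x : R,
        [/\ 1 < x, root (toC R T) x%:C, mup x%:C (toC R T) = 1%N
          & forall z : R[i], root (toC R T) z -> 1 < `|z| -> z = x%:C]
    & exists2 z : R[i], root (toC R T) z & `|z| = 1].

(* Main.v *)
Require Import Defs.
From mathcomp Require Import all_boot all_order all_algebra.
From mathcomp Require Import complex.
From mathcomp Require Import reals.
From mathcomp Require Import ring lra zify.
Import Order.TTheory GRing.Theory Num.Theory.
Local Open Scope ring_scope.

(** The relation (z - 1) T = z P - P^* is affine in P. Since T is reciprocal of
    even degree 2k, it has the explicit monic integer solution
    P0 = z^(2k) + sum_(i < k) (t_i - t_(i+1)) z^i, and adding to P0 any multiple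
    of a reciprocal S of degree 2k - 1 gives another one, because
    z S - z^(2k) S(1/z) = 0. So we look for an integer S such that P0 + N S has
    no root in the closed unit disc once N is large.

    Suppose that all roots of S are simple and lie on the unit circle. Away
    from them |S| is bounded below on the disc, so N S dominates P0. Near a
    root w, write S = (z - w) h; a root z of P0 + N S close to w satisfies
    z / w - 1 = - P0(z) / (N w h(z)), whose real part is positive by continuity
    if Re (P0(w) / (w h(w))) < 0; then |z| > 1. This perturbation argument is
    [no_root_in_disc].

    It remains to choose S so that this sign condition holds at each root. In
    the variable x = z + 1/z, T becomes a polynomial Q with simple real roots
    x_0 < ... < x_n (n = k - 1), all in (-2, 2) except that, for a Salem
    polynomial, x_n > 2 ([prod_inverse_pairs], [root_trace]). Take S to be
    (z + 1) prod_j (z^2 - a_j z + 1), up to clearing denominators, with a_j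
    rational and x_j < a_j < min (x_(j+1), 2). On the unit circle the relation
    satisfied by P0 reads w P0(w) - w^(2k) conj (P0(w)) = (w - 1) T(w), and it
    determines the real part in the sign condition: its sign is that of
    Q(a_i) prod_(j != i) (a_i - a_j) when w + 1/w = a_i, and of
    Q(-2) prod_j (-2 - a_j) when w = -1 ([outward_at_conjugate_pair],
    [outward_at_N1]). Both are negative because the a_j interlace the x_j
    ([interlacing_prod_lt0], [prod_lt0_left]). As every a_j lies below x_n,
    the largest trace x_n may be on either side of 2, and the cyclotomic and
    Salem cases are treated together. *)

(** * Perturbing a polynomial with all its roots on the unit circle *)

Lemma norm_horner_disc (C : numDomainType) (p : {poly C}) (z : C) :
  `|z| <= 1 -> `|p.[z]| <= \sum_(i < size p) `|p`_i|.
Proof.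
move=> z1; rewrite horner_coef (le_trans (ler_norm_sum _ _ _))//.
apply: ler_sum => i _; rewrite normrM normrX.
by rewrite ler_piMr ?normr_ge0// exprn_ile1.
Qed.

Lemma horner_lipschitz_disc {C : numFieldType} (p : {poly C}) (w : C) :
  exists2 K, 0 <= K &
    forall z, `|z| <= 1 -> `|p.[z] - p.[w]| <= K * `|z - w|.
Proof.
have /factor_theorem[q eq_q] : root (p - p.[w]%:P) w.
  by rewrite /root !hornerE subrr.
exists (\sum_(i < size q) `|q`_i|); first exact: sumr_ge0.
move=> z z1; have -> : p.[z] - p.[w] = q.[z] * (z - w).
  by have := congr1 (horner^~ z) eq_q; rewrite !hornerE.
by rewrite normrM ler_wpM2r// norm_horner_disc.
Qed.

(** If p(z) + t (z - w) h(z) = 0, multiplying by the conjugate of w h(z) gives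
    p(z) conj (w h(z)) + t |h(z)|^2 (z - w) conj w = 0. On the disc the second
    term has real part <= 0, and near w the first one has negative real part by
    continuity. *)
Lemma root_pushed_out {C : numClosedFieldType} (p h : {poly C}) (w : C) :
    `|w| = 1 -> 'Re (p.[w] * (w * h.[w])^*) < 0 ->
  exists2 e, 0 < e & forall z, `|z| <= 1 -> `|z - w| < e ->
    forall t, 0 <= t -> p.[z] + t * ((z - w) * h.[z]) != 0.
Proof.
move=> w1 Ew.
have [Kp Kp0 Kp_lip] := horner_lipschitz_disc p w.
have [Kh Kh0 Kh_lip] := horner_lipschitz_disc h w.
pose B := \sum_(i < size h) `|h`_i|.
have B0 : 0 <= B by apply: sumr_ge0.
(* K is a Lipschitz constant on the disc for z |-> p(z) conj (w h(z)); the
   summand 1 only makes it positive. *)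
pose K := Kp * B + `|p.[w]| * Kh + 1.
have K0 : 0 < K by rewrite ltr_wpDl// addr_ge0// mulr_ge0.
exists (- 'Re (p.[w] * (w * h.[w])^*) / K).
  by rewrite divr_gt0// oppr_gt0.
move=> z z1 zw t t0; apply/eqP => eq0.
pose E y := p.[y] * (w * h.[y])^*.
have Elip : `|E z - E w| <= K * `|z - w|.
  have -> : E z - E w =
      (p.[z] - p.[w]) * (w * h.[z])^* + p.[w] * (w * (h.[z] - h.[w]))^*.
    by rewrite /E mulrBr rmorphB/=; ring.
  rewrite (le_trans (ler_normD _ _))// !normrM !norm_conjC !normrM w1 !mul1r.
  rewrite !mulrDl mul1r ler_wpDr// lerD//.
    by rewrite mulrAC ler_pM ?Kp_lip// norm_horner_disc.
  by rewrite -mulrA ler_wpM2l// Kh_lip.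
have Ez : 'Re (E z) < 0.
  rewrite -[E z](subrK (E w)) raddfD/= -[ltRHS](addNr ('Re (E w))) ltrD2r.
  rewrite (le_lt_trans (leif_Re_Creal _))// (le_lt_trans Elip)//.
  by rewrite mulrC -ltr_pdivlMr.
have : 'Re (E z) + t * `|h.[z]| ^+ 2 * 'Re ((z - w) * w^*) = 0.
  have tR : t * `|h.[z]| ^+ 2 \is Num.real.
    by rewrite ger0_real// mulr_ge0// exprn_ge0.
  rewrite -ReMl// -raddfD/=; apply: (etrans _ (raddf0 _)); congr ('Re _).
  rewrite -[RHS](mul0r ((w * h.[z])^*)) -eq0 normCK /E rmorphM/=; ring.
have : 'Re ((z - w) * w^*) <= 0.
  rewrite mulrBl -normCK w1 expr1n raddfB/= subr_le0.
  rewrite (_ : 'Re 1 = 1); last by apply/Creal_ReP.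
  by rewrite (le_trans (leif_Re_Creal _))// normrM norm_conjC w1 mulr1.
move=> H /eqP; apply/negP; rewrite lt_eqF//.
by rewrite (le_lt_trans _ Ez)// gerDl mulr_ge0_le0// mulr_ge0// exprn_ge0.
Qed.

(** The radii given by the hypothesis multiply to the bound d: a point of the
    disc that is outside all the small discs is at distance at least the
    radius from each w. Keeping G abstract lets the bound be built by induction
    on ws while G speaks of the whole product. *)
Lemma prod_dist_bounded_below {C : numFieldType} (G : C -> Prop) (ws : seq C) :
    (forall w, w \in ws ->
       exists2 e, 0 < e & forall z, `|z| <= 1 -> `|z - w| < e -> G z) ->
  exists2 d, 0 < d & forall z, `|z| <= 1 ->
    G z \/ d <= `|\prod_(w <- ws) (z - w)|.
Proof.
elim: ws => [|w ws IH] Gws.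
  by exists 1 => // z _; right; rewrite big_nil normr1.
have [|d d0 Hd] := IH.
  by move=> v v_ws; apply: Gws; rewrite inE v_ws orbT.
have [e e0 He] := Gws w (mem_head _ _).
exists (e * d); first exact: mulr_gt0.
move=> z z1; have [Gz|dz] := Hd z z1; first by left.
have [zw|zw] := real_ltP (normr_real (z - w)) (gtr0_real e0).
- by left; apply: He.
- by right; rewrite big_cons normrM ler_pM// ltW.
Qed.

(** Near ws the perturbation pushes the roots out ([root_pushed_out]); elsewhere
    on the disc t |s| exceeds |p|. *)
Theorem no_root_in_disc {C : numClosedFieldType} (p s : {poly C}) (c : C)
    (ws : seq C) :
    c != 0 -> s = c *: \prod_(w <- ws) ('X - w%:P) ->
    (forall w, w \in ws -> `|w| = 1 /\
       exists2 h, s = ('X - w%:P) * h & 'Re (p.[w] * (w * h.[w])^*) < 0) ->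
  exists2 B, 0 <= B & forall t, B < t ->
    forall z, `|z| <= 1 -> (p + t *: s).[z] != 0.
Proof.
move=> c0 s_ws Hws.
pose G z := forall t, 0 <= t -> (p + t *: s).[z] != 0.
have [w w_ws|d d0 Hd] := @prod_dist_bounded_below _ G ws.
  have [w1 [h sE hw]] := Hws w w_ws.
  have [e e0 He] := root_pushed_out p h w w1 hw.
  exists e => // z z1 zw t t0; rewrite sE hornerD hornerZ hornerM hornerXsubC.
  exact: He.
pose M := \sum_(i < size p) `|p`_i|.
have M0 : 0 <= M by apply: sumr_ge0.
have cd0 : 0 < `|c| * d by rewrite mulr_gt0// normr_gt0.
exists (M / (`|c| * d)); first by rewrite divr_ge0// ltW.
move=> t Mt z z1.
have t0 : 0 < t by rewrite (le_lt_trans _ Mt)// divr_ge0// ltW.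
have [Gz|dz] := Hd z z1; first exact: Gz (ltW t0).
apply/eqP; rewrite hornerD => /eqP; rewrite addr_eq0 => /eqP /(congr1 Num.norm).
apply/eqP; rewrite lt_eqF// (le_lt_trans (norm_horner_disc _ _ _ z1))//.
move: Mt; rewrite ltr_pdivrMr// => /lt_le_trans -> //.
rewrite normrN hornerZ normrM gtr0_norm// ler_pM2l//.
rewrite s_ws hornerZ normrM ler_pM2l ?normr_gt0//.
rewrite horner_prod (eq_bigr (fun w => z - w))// => w _; by rewrite !hornerE.
Qed.

(** * Reciprocal polynomials *)

Lemma coef_reciprocal {A : nzRingType} (P : {poly A}) (j : nat) :
  (reciprocal P)`_j = if (j < size P)%N then P`_((size P).-1 - j) else 0.
Proof.
rewrite /reciprocal coef_sum; under eq_bigr do rewrite coefZ coefXn.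
move: (size P) => n; case: ltnP => [j_lt|j_ge]; last first.
  rewrite big1// => i _; have := ltn_ord i => i_lt.
  by rewrite gtn_eqF ?mulr0//; lia.
have k_lt : (n.-1 - j < n)%N by lia.
rewrite (bigD1 (Ordinal k_lt))//= big1 => [|i].
  by rewrite addr0 (_ : j == _) ?mulr1//; lia.
rewrite -val_eqE/= => i_neq; have i_lt := ltn_ord i.
by rewrite (_ : (j == _) = false) ?mulr0//; apply/eqP; lia.
Qed.

Lemma reciprocal_map {A B : nzRingType} (f : {rmorphism A -> B})
    (P : {poly A}) :
  injective f -> reciprocal (map_poly f P) = map_poly f (reciprocal P).
Proof.
move=> f_inj; apply/polyP => j.
rewrite coef_map/= !coef_reciprocal size_map_inj_poly ?rmorph0//= coef_map/=.
by case: ifP => // _; rewrite rmorph0.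
Qed.

Lemma eq_poly_horner_neq0 {F : numFieldType} (p q : {poly F}) :
  (forall z, z != 0 -> p.[z] = q.[z]) -> p = q.
Proof.
move=> pq; apply/subr0_eq.
apply: (@roots_geq_poly_eq0 _ _ [seq i.+1%:R | i <- iota 0 (size (p - q))]).
- by apply/allP => _ /mapP[i _ ->]; rewrite /root !hornerE pq ?subrr ?pnatr_eq0.
- by rewrite map_inj_uniq ?iota_uniq// => i j /eqP; rewrite eqr_nat => /eqP[].
- by rewrite size_map size_iota.
Qed.

Lemma is_reciprocal_horner {F : numFieldType} (p : {poly F}) :
  (forall z, z != 0 -> p.[z] = z ^+ (size p).-1 * p.[z^-1]) -> is_reciprocal p.
Proof.
move=> pE; apply: eq_poly_horner_neq0 => z z0.
by rewrite horner_reciprocal// -pE.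
Qed.

(** * Products of quadratics in the variable z + 1/z *)

(** For a unit z, the polynomial with roots z and z^-1 is quad (z + z^-1). *)
Definition quad {A : nzRingType} (x : A) : {poly A} := 'X^2 - x *: 'X + 1.

Lemma size_quad {A : nzRingType} (x : A) : size (quad x) = 3.
Proof.
rewrite /quad -addrA size_polyDl size_polyXn// (leq_ltn_trans (size_polyD _ _))//.
rewrite size_polyN size_poly1 gtn_max andbT.
by rewrite (leq_ltn_trans (size_scale_leq _ _))// size_polyX.
Qed.

Lemma quad_monic {A : nzRingType} (x : A) : quad x \is monic.
Proof.
by rewrite monicE lead_coefE size_quad /quad !coefE/= mulr0 subr0 addr0.
Qed.

Lemma quadE {F : fieldType} (z : F) : z != 0 ->
  quad (z + z^-1) = ('X - z%:P) * ('X - z^-1%:P).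
Proof.
move=> z0; rewrite /quad scalerDl -!mul_polyC.
have : z%:P * (z^-1)%:P = 1 :> {poly F} by rewrite -polyCM divff.
by move=> H; rewrite -[1 in LHS]H; ring.
Qed.

Lemma horner_quad {F : fieldType} (x w : F) : w != 0 ->
  (quad x).[w] = w * (w + w^-1 - x).
Proof. by move=> w0; rewrite /quad !hornerE; field. Qed.

Lemma prod_quad_monic {A : comNzRingType} (xs : seq A) :
  \prod_(x <- xs) quad x \is monic.
Proof. by apply: monic_prod => x _; exact: quad_monic. Qed.

Lemma size_prod_quad {A : idomainType} (xs : seq A) :
  size (\prod_(x <- xs) quad x) = (size xs).*2.+1.
Proof.
elim: xs => [|x xs IH]; first by rewrite big_nil size_poly1.
rewrite big_cons size_monicM ?quad_monic ?monic_neq0 ?prod_quad_monic//.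
by rewrite size_quad IH /= doubleS; lia.
Qed.

Lemma horner_prod_quad {F : fieldType} (xs : seq F) (w : F) : w != 0 ->
  (\prod_(x <- xs) quad x).[w] =
  w ^+ size xs * \prod_(x <- xs) (w + w^-1 - x).
Proof.
move=> w0; elim: xs => [|x xs IH]; first by rewrite !big_nil hornerE mul1r.
by rewrite !big_cons hornerM IH horner_quad// exprS; ring.
Qed.

Lemma horner_prod_quad_fin {F : fieldType} {I : finType} (Q : pred I)
    (f : I -> F) (w : F) : w != 0 ->
  (\prod_(i | Q i) quad (f i)).[w] =
  w ^+ #|Q| * \prod_(i | Q i) (w + w^-1 - f i).
Proof.
move=> w0; rewrite horner_prod; under eq_bigr do rewrite horner_quad//.
by rewrite big_split/= prodr_const.
Qed.

Lemma prod_quad_reciprocal {F : numFieldType} (xs : seq F) :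
  is_reciprocal (\prod_(x <- xs) quad x).
Proof.
apply: is_reciprocal_horner => z z0.
rewrite size_prod_quad !horner_prod_quad ?invr_eq0// invrK [z^-1 + z]addrC.
rewrite mulrA; congr (_ * _).
by rewrite -addnn exprD -mulrA -exprMn divff// expr1n mulr1.
Qed.

(** Inversion acts on rs without fixed points, so its orbits are pairs; each
    pair {z, z^-1} contributes one quadratic factor, and z + z^-1 determines
    the pair. *)
Lemma prod_inverse_pairs {F : fieldType} (rs : seq F) :
    uniq rs ->
    (forall z, z \in rs -> [/\ z != 0, z^-1 \in rs & z^-1 != z]) ->
  exists xs : seq F,
    [/\ uniq xs, \prod_(z <- rs) ('X - z%:P) = \prod_(x <- xs) quad x
      & forall x, x \in xs -> exists2 z, z \in rs & x = z + z^-1].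
Proof.
have [n] := ubnP (size rs); elim: n rs => // n IH [|z rs] /=.
  by move=> _ _ _; exists [::]; split; rewrite ?big_nil.
rewrite ltnS => rs_n /andP[z_rs rs_uniq] rs_inv.
have [z0 + zV] := rs_inv z (mem_head _ _).
rewrite inE (negPf zV)/= => zV_rs.
have mem_rs' u : (u \in rem z^-1 rs) = (u != z^-1) && (u \in rs).
  by rewrite mem_rem_uniq// inE.
have [|||xs [xs_uniq xsE xs_rs]] := IH (rem z^-1 rs).
- by rewrite size_rem//; move: rs_n zV_rs; case: (rs) => [|? ?] //= /ltnW.
- exact: rem_uniq.
- move=> u; rewrite mem_rs' => /andP[uzV u_rs].
  have [|u0 uV_rs uV] := rs_inv u; first by rewrite inE u_rs orbT.
  split=> //; move: uV_rs; rewrite mem_rs' inE (inj_eq invr_inj).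
  case: eqP => [uz|_ /= ->]; first by rewrite -uz invrK eqxx in uzV.
  by rewrite andbT (memPn z_rs).
exists (z + z^-1 :: xs); split.
- rewrite /= xs_uniq andbT; apply/negP => /xs_rs[u].
  rewrite mem_rs' => /andP[uzV u_rs] /eqP.
  have [|u0 _ _] := rs_inv u; first by rewrite inE u_rs orbT.
  apply/negP; rewrite -subr_eq0.
  have -> : z + z^-1 - (u + u^-1) = (z - u) * (u - z^-1) / u.
    by field; rewrite z0 u0.
  rewrite !mulf_neq0 ?invr_eq0 ?subr_eq0// eq_sym.
  exact: (memPn z_rs).
- rewrite !big_cons -xsE (perm_big _ (perm_to_rem zV_rs))/= big_cons.
  by rewrite mulrA quadE.
- move=> x; rewrite inE => /predU1P[->|/xs_rs[u]].
    by exists z; rewrite ?mem_head.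
  by rewrite mem_rs' => /andP[_ u_rs] ->; exists u; rewrite // inE u_rs orbT.
Qed.

(** * Signs of products over interlacing sequences *)

(** Pair the factor of x_(j+1) with that of a_j for j != i: x_(j+1) and a_j lie
    on the same side of a_i. What remains is (a_i - x_0) (a_i - x_(i+1)) < 0. *)
Lemma interlacing_prod_lt0 {R : realDomainType} (n : nat) (x a : nat -> R) :
    (forall j, (j < n)%N -> x j < a j < x j.+1) ->
  forall i : 'I_n,
    (\prod_(j < n.+1) (a i - x j)) * \prod_(j < n | j != i) (a i - a j) < 0.
Proof.
move=> xa i.
have x_le j k : (j <= k)%N -> (k <= n)%N -> x j <= x k.
  elim: k => [|k IH]; first by rewrite leqn0 => /eqP->.
  rewrite leq_eqVlt => /predU1P[-> //|jk] kn.
  rewrite (le_trans (IH jk (ltnW kn)))//.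
  by have /andP[/lt_trans xk /xk /ltW] := xa k kn.
have xa_lt j k : (j <= k)%N -> (k < n)%N -> x j < a k.
  move=> jk kn; have /andP[xk _] := xa k kn.
  exact: le_lt_trans (x_le _ _ jk (ltnW kn)) xk.
have ax_lt j k : (j < k)%N -> (k <= n)%N -> a j < x k.
  move=> jk kn; have /andP[_ xj] := xa j (leq_trans jk kn).
  exact: lt_le_trans xj (x_le _ _ jk kn).
rewrite big_ord_recl/= (bigD1 i)//= mulrA -mulrA -big_split/=.
rewrite pmulr_llt0 ?pmulr_rlt0 ?subr_gt0 ?subr_lt0.
- exact: ax_lt.
- exact: xa_lt.
- apply: prodr_gt0 => j; rewrite -val_eqE neq_ltn /= => /orP[ji|ij].
  + rewrite mulr_gt0// subr_gt0 ?xa_lt//.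
    exact: lt_trans (ax_lt _ _ (ltnSn j) (ltn_ord j)) (xa_lt _ _ ji (ltn_ord i)).
  + rewrite nmulr_rgt0 subr_lt0 ?ax_lt ?leqW//.
    exact: lt_trans (ax_lt _ _ (ltnSn i) (ltn_ord i)) (xa_lt _ _ ij (ltn_ord j)).
Qed.

Lemma prod_lt0_left {R : realDomainType} (n : nat) (x a : nat -> R) (b : R) :
    (forall j, (j <= n)%N -> b < x j) -> (forall j, (j < n)%N -> b < a j) ->
  (\prod_(j < n.+1) (b - x j)) * \prod_(j < n) (b - a j) < 0.
Proof.
move=> bx ba; rewrite big_ord_recl -mulrA -big_split/=.
rewrite pmulr_llt0 ?subr_lt0 ?bx//; apply: prodr_gt0 => j _.
by rewrite nmulr_rgt0 subr_lt0 ?ba ?bx.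
Qed.

(** * Solutions of the affine relation *)

(** The relation ('X - 1) T = 'X P - P^* equates p_(j-1) - p_(m-j) with
    t_(j-1) - t_j, where m = k.*2. This solution is the one with zero
    coefficients from index k to m - 1. *)
Definition base_solution (k : nat) (T : {poly int}) : {poly int} :=
  'X^(k.*2) + \poly_(i < k) (T`_i - T`_i.+1).

(** In the j-th coefficient of 'X P - P^* the contribution of S is
    c (s_(j-1) - s_(m-j)), which vanishes as S is reciprocal of degree m - 1;
    and since S has degree below m, the sum stays monic of degree m. *)
Lemma base_solutionP (k : nat) (T S : {poly int}) (c : int)
    (P := base_solution k T + c *: S) :
    is_reciprocal T -> size T = k.*2.+1 -> T \is monic ->
    is_reciprocal S -> size S = k.*2 ->
  [/\ P \is monic, size P = k.*2.+1 & ('X - 1) * T = 'X * P - reciprocal P].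
Proof.
move=> T_rec T_size T_monic S_rec S_size.
have PE j : P`_j = (j == k.*2)%:R +
    (if (j < k)%N then T`_j - T`_j.+1 else 0) + c * S`_j.
  by rewrite /P /base_solution !coefE.
have P_size : size P = k.*2.+1.
  rewrite /P /base_solution -addrA size_polyDl size_polyXn//.
  rewrite (leq_ltn_trans (size_polyD _ _))// gtn_max !ltnS.
  rewrite (leq_trans (size_poly _ _)) -?addnn ?leq_addr//=.
  by rewrite (leq_trans (size_scale_leq _ _))// S_size addnn.
have P_monic : P \is monic.
  rewrite monicE lead_coefE P_size/= PE eqxx ifN; last by lia.
  by rewrite [S`__]nth_default ?S_size// mulr0 !addr0.
split=> //; apply/polyP => j.
rewrite mulrBl mul1r !coefB !coefXM coef_reciprocal P_size ltnS/=.
have tm : T`_k.*2 = 1 by move/monicP: T_monic; rewrite lead_coefE T_size.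
have t_sym i : (i <= k.*2)%N -> T`_(k.*2 - i) = T`_i.
  by move=> ik; rewrite -[in RHS]T_rec coef_reciprocal T_size ltnS ik.
have s_sym i : (i < k.*2)%N -> S`_(k.*2.-1 - i) = S`_i.
  by move=> ik; rewrite -[in RHS]S_rec coef_reciprocal S_size ik.
have t0 : T`_0 = 1 by rewrite -t_sym// subn0.
case: j => [|j] /=.
  by rewrite subn0 PE eqxx ifN ?[S`__]nth_default ?S_size ?t0; lia.
case: ltnP => jk; last first.
  rewrite [T`_j.+1]nth_default ?T_size// !subr0.
  move: jk; rewrite leq_eqVlt => /predU1P[<-|jk].
    by move/monicP: P_monic; rewrite lead_coefE P_size/= => ->.
  by rewrite !nth_default ?P_size ?T_size.
have -> : (k.*2 - j.+1 = k.*2.-1 - j)%N by lia.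
rewrite !PE s_sym// ltn_eqF// (_ : _ == k.*2 = false); last by lia.
case: (ltnP j k) => jk'.
  by rewrite ifN; [ring | lia].
rewrite ifT; last by lia.
have -> : (k.*2.-1 - j).+1 = (k.*2 - j)%N by lia.
have -> : (k.*2.-1 - j)%N = (k.*2 - j.+1)%N by lia.
by rewrite !t_sym //; [ring | lia].
Qed.

(** * The direction in which the roots move *)

Lemma norm1_neq0 {C : numDomainType} (w : C) : `|w| = 1 -> w != 0.
Proof. by move=> w1; rewrite -normr_eq0 w1 oner_eq0. Qed.

Lemma norm1_conjC {C : numClosedFieldType} (w : C) : `|w| = 1 -> w^* = w^-1.
Proof. by move=> w1; rewrite invC_norm w1 expr1n invr1 mul1r. Qed.

(** With y = P0(w), the second factor is w h(w), where (z - w) h is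
    c (z + 1) prod_j (z^2 - a_j z + 1) with w + w^-1 = a_i, and v is
    prod_(j != i) (a_i - a_j). The conjugate of w h(w) is - w^-(2k-1) w h(w)
    with k = n + 2, so twice the real part only involves
    y - w^(2k-1) y^*, which the relation on P0 expresses through q = Q(a_i). *)
Lemma outward_at_conjugate_pair {C : numClosedFieldType} (n : nat)
    (w y q v c : C) :
    `|w| = 1 -> v \is Num.real -> c \is Num.real ->
    w * y - w ^+ n.+2.*2 * y^* = (w - 1) * (w ^+ n.+2 * q) ->
  'Re (y * (w * (c * ((w + 1) * (w - w^-1) * (w ^+ n * v))))^*) =
  - (c * (q * v) * ((w + w^-1) ^+ 2 - 4)) / 2.
Proof.
move=> w1 vR cR rel; have w0 := norm1_neq0 w w1.
rewrite ReE [(y * _)^*]rmorphM/= conjCK.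
rewrite !(rmorphM, rmorphB, rmorphD, rmorphXn, rmorph1, fmorphV)/=.
rewrite (norm1_conjC w w1) (conj_Creal vR) (conj_Creal cR) invrK.
move: rel; rewrite -addnn exprD !exprS exprVn.
have := expf_neq0 n w0; move: (w ^+ n) (y^*) => W u W0 rel.
have -> : y =
    (w * (w * W) * (w * (w * W)) * u + (w - 1) * (w * (w * W) * q)) / w.
  by rewrite -rel addrC subrK mulrC mulKf.
by field; rewrite w0 W0.
Qed.

(** The analogue of [outward_at_conjugate_pair] at w = -1. There the relation
    determines P0(-1) itself, since P0(-1) is real. *)
Lemma outward_at_N1 {C : numClosedFieldType} (n : nat) (y q v c : C) :
    y^* = y -> q \is Num.real -> v \is Num.real -> c \is Num.real ->
    -1 * y - (-1) ^+ n.+1.*2 * y^* = (-1 - 1) * ((-1) ^+ n.+1 * q) ->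
  'Re (y * (-1 * (c * ((-1) ^+ n * v)))^*) = c * (q * v).
Proof.
move=> yR qR vR cR; rewrite -signr_odd odd_double expr0 yR => rel.
rewrite !(rmorphM, rmorphXn, rmorphN, rmorph1)/=.
rewrite (conj_Creal vR) (conj_Creal cR).
have -> : y = (-1) ^+ n.+1 * q.
  apply: (@mulfI _ (-1 - 1)); last by rewrite -rel mul1r mulrBl mulN1r mul1r.
  by rewrite -opprD oppr_eq0 -(natrD _ 1 1) pnatr_eq0.
have -> : (-1) ^+ n.+1 * q * (-1 * (c * ((-1) ^+ n * v))) = c * (q * v) :> C.
  rewrite exprS.
  have : (-1) ^+ n * (-1) ^+ n = 1 :> C by rewrite -exprMn mulrNN mulr1 expr1n.
  move: ((-1) ^+ n) => e ee; rewrite -[RHS]mul1r -[X in _ = X * _]ee; ring.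
by apply/Creal_ReP; rewrite !rpredM.
Qed.

Lemma unit_circle_trace {C : numClosedFieldType} (a : C) : -2 < a < 2 ->
  exists2 w, `|w| = 1 & w + w^-1 = a.
Proof.
move=> /andP[a_gt a_lt].
have aR : a \is Num.real by rewrite -(ger_real (ltW a_lt)) realn.
have b0 : 0 <= 1 - (a / 2) ^+ 2.
  have -> : 1 - (a / 2) ^+ 2 = (2 - a) * (a - - 2) / 4 by field.
  by rewrite divr_ge0 ?mulr_ge0// subr_ge0 ltW.
pose b := sqrtC (1 - (a / 2) ^+ 2).
have bR : b \is Num.real by rewrite ger0_real// sqrtC_ge0.
have a2R : a / 2 \is Num.real by rewrite rpred_div// realn.
pose w : C := a / 2 + 'i * b.
have w_norm : `|w| ^+ 2 = (a / 2) ^+ 2 + b ^+ 2 by exact: normC2_rect.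
have w_conj : w^* = a / 2 - 'i * b by exact: conjC_rect.
have w1 : `|w| = 1.
  by apply/eqP; rewrite -(@eqrXn2 _ 2)// expr1n w_norm sqrtCK addrC subrK.
by exists w => //; rewrite -norm1_conjC// w_conj /w; field.
Qed.

(** * Construction of the expansive polynomial *)

Lemma toC_inj {R : realType} : injective (toC R).
Proof. by apply: map_inj_poly => //; exact: intr_inj. Qed.

Lemma size_toC {R : realType} (P : {poly int}) : size (toC R P) = size P.
Proof. by rewrite /toC size_map_inj_poly//; exact: intr_inj. Qed.

Lemma reciprocal_toC {R : realType} (P : {poly int}) :
  reciprocal (toC R P) = toC R (reciprocal P).
Proof. by apply: reciprocal_map; exact: intr_inj. Qed.

Lemma toC_conj {R : realType} (P : {poly int}) (z : R[i]) :
  (toC R P).[z]^* = (toC R P).[z^*].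
Proof.
rewrite -horner_map/= /toC -map_poly_comp; congr (_.[_]).
by apply: eq_map_poly => k /=; rewrite rmorph_int.
Qed.

(** The polynomial quad q with its denominators cleared. *)
Definition int_quad (q : rat) : {poly int} :=
  denq q *: 'X^2 - numq q *: 'X + (denq q)%:P.

Lemma toC_int_quad {R : realType} (q : rat) :
  toC R (int_quad q) = (denq q)%:~R *: quad ((ratr q : R)%:C)%C.
Proof.
have -> : ((ratr q : R)%:C)%C = ratr q by rewrite fmorph_rat.
rewrite /toC /int_quad rmorphD rmorphB /= !map_polyZ/= map_polyXn map_polyX.
rewrite map_polyC/= /quad scalerDr scalerBr scalerA alg_polyC.
congr (_ - _ *: _ + _); rewrite /ratr mulrC divfK//.
by rewrite intr_eq0 denq_eq0.
Qed.

Lemma int_prod_quad {R : realType} (n : nat) (a : nat -> rat)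
    (S := ('X + 1) * \prod_(j < n) int_quad (a j))
    (c := \prod_(j < n) (denq (a j))%:~R : R) :
  [/\ 0 < c, size S = n.+1.*2, is_reciprocal S &
    toC R S = c%:C%C *:
     (('X + 1) * \prod_(j < n) quad ((ratr (a j) : R)%:C)%C)].
Proof.
have c0 : 0 < c by apply: prodr_gt0 => j _; rewrite ltr0z denq_gt0.
have SE : toC R S = c%:C%C *:
    (('X + 1) * \prod_(j < n) quad ((ratr (a j) : R)%:C)%C).
  rewrite /toC /S rmorphM/= rmorph_prod/= rmorphD/= map_polyX rmorph1.
  under eq_bigr do rewrite -/(toC R _) toC_int_quad.
  rewrite scaler_prod -scalerAr; congr (_ *: _); rewrite rmorph_prod.
  by apply: eq_bigr => j _; rewrite rmorph_int.
pose bs := [seq ((ratr (a (val j)) : R)%:C)%C | j <- enum 'I_n].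
have prodE : \prod_(j < n) quad ((ratr (a j) : R)%:C)%C = \prod_(b <- bs) quad b.
  by rewrite big_map -big_enum.
have bs_size : size bs = n by rewrite size_map size_enum_ord.
have cC0 : c%:C%C != 0 :> R[i] by rewrite fmorph_eq0 gt_eqF.
have S_size : size S = n.+1.*2.
  rewrite -(size_toC (R := R)) SE size_scale// prodE.
  rewrite (_ : 'X + 1 = 'X - (-1)%:P); last by rewrite polyCN opprK.
  by rewrite size_monicM ?monicXsubC ?monic_neq0 ?prod_quad_monic//
     size_XsubC size_prod_quad bs_size.
split=> //; apply: (toC_inj (R := R)); rewrite -reciprocal_toC.
apply: is_reciprocal_horner => z z0; rewrite size_toC S_size SE prodE.
rewrite !hornerZ !hornerM !horner_prod_quad ?invr_eq0//.
rewrite bs_size invrK [z^-1 + z]addrC !hornerE exprVn.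
rewrite doubleS/= -addnn exprS exprD.
have := expf_neq0 n z0; move: (z ^+ n) => Z Z0.
by field; rewrite z0 Z0.
Qed.

(** Here x_n may exceed 2, which is the Salem case: only the roots of the
    perturbing polynomial S have to be on the circle, and their traces a_j are
    taken in (-2, 2). *)
Theorem expansive_of_traces {R : realType} (n : nat) (T : {poly int})
    (x : nat -> R) :
    toC R T = \prod_(j < n.+1) quad (x j)%:C%C ->
    (forall j, (j < n)%N -> x j < x j.+1) ->
    -2 < x 0 -> (forall j, (j < n)%N -> x j < 2) ->
  exists P : {poly int},
    [/\ P \is monic, size P = n.+1.*2.+1, expansive (toC R P)
      & ('X - 1) * T = 'X * P - reciprocal P].
Proof.
move=> TE x_lt x0 x2.
have [a a_itv] : {a : nat -> rat & forall j, (j < n)%N ->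
    x j < ratr (a j) < Num.min (x j.+1) 2}.
  apply: (@boolp.choice _ _ (fun j q =>
    (j < n)%N -> x j < ratr q < Num.min (x j.+1) 2)) => j.
  case: (ltnP j n) => jn; last by exists 0.
  have [|q] := @rat_in_itvoo _ (x j) (Num.min (x j.+1) 2).
    by rewrite lt_min x_lt ?x2.
  by rewrite in_itv /= => qj; exists q.
pose b j : R := ratr (a j).
have xb j : (j < n)%N -> x j < b j < x j.+1.
  by move=> /a_itv/andP[-> /= bj]; rewrite (lt_le_trans bj)// ge_min lexx.
have x_gt j : (j <= n)%N -> -2 < x j.
  elim: j => // j IH jn; exact: lt_trans (IH (ltnW jn)) (x_lt j jn).
have b_itv j : (j < n)%N -> -2 < b j < 2.
  move=> jn; have /andP[xbj _] := xb j jn.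
  rewrite (lt_trans (x_gt j (ltnW jn)) xbj)/=.
  by have /andP[_] := a_itv j jn; rewrite lt_min => /andP[].
have [w w_circ] : {w : nat -> R[i] & forall j, (j < n)%N ->
    `|w j| = 1 /\ w j + (w j)^-1 = (b j)%:C%C}.
  apply: (@boolp.choice _ _ (fun j w =>
    (j < n)%N -> `|w| = 1 /\ w + w^-1 = (b j)%:C%C)) => j.
  case: (ltnP j n) => jn; last by exists 0.
  have [|w w1 wb] := @unit_circle_trace _ (b j)%:C%C; last by exists w.
  have -> : -2 = (-2 : R)%:C%C :> R[i] by rewrite rmorphN rmorph_nat.
  have -> : 2 = (2 : R)%:C%C :> R[i] by rewrite rmorph_nat.
  by rewrite !ltcR b_itv.
have := int_prod_quad (R := R) n a.
set S := (_ * _ : {poly int}); set c := (\prod_(j < n) _ : R).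
move=> [c0 S_size S_rec SE].
pose xs := [seq (x (val j))%:C%C | j <- enum 'I_n.+1].
have TE' : toC R T = \prod_(y <- xs) quad y by rewrite TE big_map -big_enum.
have xs_size : size xs = n.+1 by rewrite size_map size_enum_ord.
have T_size : size T = n.+1.*2.+1.
  by rewrite -(size_toC (R := R)) TE' size_prod_quad xs_size.
have T_rec : is_reciprocal T.
  apply: (toC_inj (R := R)); rewrite -reciprocal_toC TE'.
  exact: prod_quad_reciprocal.
have T_monic : T \is monic.
  have := prod_quad_monic xs; rewrite -TE' !monicE /toC.
  rewrite lead_coef_map_inj ?mulr0z//; last exact: intr_inj.
  by rewrite -(eqr_int R[i]).
pose P0 := base_solution n.+1 T.
(* On the circle the reciprocal of a real polynomial is its conjugate up to a
   power of u, as u^-1 = u^*. *)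
have P0_rel (u : R[i]) : `|u| = 1 ->
    u * (toC R P0).[u] - u ^+ n.+1.*2 * (toC R P0).[u]^* =
    (u - 1) * (u ^+ n.+1 * \prod_(j < n.+1) (u + u^-1 - (x j)%:C%C)).
  move=> u1; have u0 := norm1_neq0 u u1.
  have [_] :=
    base_solutionP n.+1 T S 0 T_rec T_size T_monic S_rec S_size.
  rewrite scale0r addr0 -/P0 => P0_size /(congr1 (toC R))/(congr1 (horner^~ u)).
  rewrite /toC rmorphB !rmorphM/= rmorphB/= map_polyX rmorph1.
  rewrite -!/(toC R _) -reciprocal_toC hornerD hornerN !hornerM !hornerE.
  rewrite horner_reciprocal// size_toC P0_size toC_conj norm1_conjC//= => <-.
  by rewrite -mulrA TE' horner_prod_quad// xs_size big_map big_enum.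
pose ws := -1 :: [seq w (val j) | j <- index_enum 'I_n] ++
  [seq (w (val j))^-1 | j <- index_enum 'I_n].
have S_ws : toC R S = c%:C%C *: \prod_(u <- ws) ('X - u%:P).
  rewrite SE big_cons polyCN opprK big_cat !big_map.
  congr (_ *: (_ * _)).
  rewrite (eq_bigr (fun j : 'I_n => ('X - (w j)%:P) * ('X - (w j)^-1%:P))).
    exact: big_split.
  move=> j _; have [w1 <-] := w_circ j (ltn_ord j).
  by rewrite quadE ?norm1_neq0.
have ws_circ u : u \in ws -> u = -1 \/
    exists2 j : 'I_n, `|u| = 1 & u + u^-1 = (b j)%:C%C.
  rewrite inE mem_cat => /predU1P[->|/orP[]/mapP[j _ ->]]; first by left.
    by right; have [w1 wb] := w_circ j (ltn_ord j); exists j.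
  right; have [w1 wb] := w_circ j (ltn_ord j); exists j.
    by rewrite normfV w1 invr1.
  by rewrite invrK addrC.
have c0C : c%:C%C != 0 :> R[i] by rewrite fmorph_eq0 gt_eqF.
have real_C (r : R) : r%:C%C \is Num.real by apply/complex_realP; exists r.
have prodC (I : finType) (Q : pred I) (f : I -> R) (s : R) :
    \prod_(j | Q j) (s%:C%C - (f j)%:C%C) = (\prod_(j | Q j) (s - f j))%:C%C.
  by rewrite rmorph_prod; apply: eq_bigr => j _; rewrite rmorphB.
have [u|B B0 HB] := no_root_in_disc (toC R P0) (toC R S) _ ws c0C S_ws.
  case/ws_circ => [->|[i u1 ub]].
    have N1C : -1 + (-1)^-1 = (-2 : R)%:C%C :> R[i].
      by rewrite invrN1 -opprD rmorphN rmorph_nat.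
    split; first by rewrite normrN1.
    exists (c%:C%C *: \prod_(j < n) quad (b j)%:C%C).
      by rewrite SE polyCN opprK scalerAr.
    rewrite hornerZ horner_prod_quad_fin ?oppr_eq0 ?oner_eq0//.
    rewrite N1C prodC card_ord.
    rewrite (@outward_at_N1 _ _ _ (\prod_(j < n.+1) (-2 - x j))%:C%C)//.
    - rewrite -!rmorphM/= -[ltRHS]/((0 : R)%:C%C) ltcR pmulr_rlt0//.
      apply: prod_lt0_left => // j jn; by have /andP[] := b_itv j jn.
    - by rewrite toC_conj rmorphN rmorph1.
    - by have := P0_rel (-1) (normrN1 _); rewrite N1C prodC.
  split=> //.
  exists (c%:C%C *: (('X + 1) * ('X - u^-1%:P) *
                     \prod_(j < n | j != i) quad (b j)%:C%C)).
    rewrite SE (bigD1 i)//= -/(b i) -ub quadE ?norm1_neq0//.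
    by rewrite -scalerAr; congr (_ *: _); ring.
  rewrite hornerZ !hornerM horner_prod_quad_fin ?norm1_neq0//.
  rewrite ub prodC hornerXsubC hornerD hornerX hornerC.
  have n0 : n = n.-1.+1 by rewrite prednK// (leq_ltn_trans _ (ltn_ord i)).
  rewrite cardC1 card_ord.
  rewrite (@outward_at_conjugate_pair _ _ _ _
    (\prod_(j < n.+1) (b i - x j))%:C%C)//.
    rewrite ub mulNr oppr_lt0 divr_gt0// nmulr_rgt0.
      have -> : 4 = (4 : R)%:C%C :> R[i] by rewrite rmorph_nat.
      rewrite -rmorphXn -rmorphB/= -[ltRHS]/((0 : R)%:C%C) ltcR.
      have /andP[] := b_itv i (ltn_ord i); nra.
    rewrite -!rmorphM/= -[ltRHS]/((0 : R)%:C%C) ltcR pmulr_rlt0//.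
    exact: interlacing_prod_lt0.
  by rewrite -n0; have := P0_rel u u1; rewrite ub prodC.
exists (P0 + (Num.bound (complex.Re B))%:Z *: S).
have [P_monic P_size P_rel] := base_solutionP n.+1 T S
  (Num.bound (complex.Re B))%:Z T_rec T_size T_monic S_rec S_size.
split=> //; split.
- by apply/polyOverP => j; rewrite coef_map/= realz.
- by rewrite size_toC P_size.
move=> z; rewrite real_ltNge ?normr_real// => Pz.
apply/negP => z1; move: Pz; apply/negP.
have -> : toC R (P0 + (Num.bound (complex.Re B))%:Z *: S) =
    toC R P0 + (Num.bound (complex.Re B))%:R *: toC R S.
  by rewrite /toC rmorphD/= map_polyZ.
apply: HB => //.
rewrite -(RRe_real (ger0_real B0)) -(rmorph_nat (real_complex R)) ltcR.
rewrite archi_boundP//.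
by rewrite -ler0c RRe_real// ger0_real.
Qed.

(** * Roots of cyclotomic and Salem polynomials *)

Lemma norm1_trace {R : realType} (z : R[i]) : `|z| = 1 -> z^-1 != z ->
  exists2 r : R, z + z^-1 = r%:C%C & -2 < r < 2.
Proof.
move=> z1 zV; exists (2 * complex.Re z).
  rewrite rmorphM rmorph_nat/= complexRe ReE norm1_conjC//.
  by rewrite mulrCA divff ?mulr1// pnatr_eq0.
have := add_Re2_Im2 z; rewrite z1 expr1n => /(@complexI _ _ 1) ReIm.
have : complex.Im z != 0.
  apply: contra zV => /eqP Im0; rewrite -norm1_conjC// conj_Creal//.
  by case: (z) Im0 => a b /= ->; rewrite complex_real.
by rewrite -sqrf_eq0 => Im0; have := sqr_ge0 (complex.Im z); nra.
Qed.

Lemma simple_monic_factor {R : realType} (T : {poly int}) :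
    T \is monic -> simple_roots (toC R T) ->
  exists2 rs : seq R[i], uniq rs & toC R T = \prod_(z <- rs) ('X - z%:P).
Proof.
move=> T_monic T_simple.
have TC_monic : toC R T \is monic by exact: monic_map.
have [rs] := closed_field_poly_normal (toC R T).
rewrite (monicP TC_monic) scale1r => rsE; exists rs => //.
apply: count_mem_uniq => z; rewrite -mu_prod_XsubC -rsE.
have -> : (z \in rs) = root (toC R T) z by rewrite rsE root_prod_XsubC.
by case: (boolP (root _ _)) => [/T_simple -> //|/mupNroot ->].
Qed.

(** The inverse of a root on the circle is its conjugate, and T is real; for a
    Salem polynomial inversion preserves the roots because T is reciprocal. *)
Lemma root_toC_inv {R : realType} (T : {poly int}) (z : R[i]) :
    cyclotomic_poly R T \/ salem_poly R T ->
  root (toC R T) z -> z != 0 /\ root (toC R T) z^-1.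
Proof.
case=> [[_ T_circ]|[T_monic T_rec _ _]] Tz.
  have z1 := T_circ z Tz; split; first exact: norm1_neq0.
  by rewrite -norm1_conjC// /root -toC_conj conjC_eq0.
have z0 : z != 0.
  apply: contraTneq Tz => ->; rewrite /root horner_coef0 /toC coef_map/=.
  rewrite -T_rec coef_reciprocal subn0 -lead_coefE (monicP T_monic).
  by rewrite size_poly_gt0 monic_neq0// oner_eq0.
split=> //; move: Tz; rewrite /root -{1}T_rec -reciprocal_toC horner_reciprocal//.
by rewrite mulf_eq0 expf_eq0 (negPf z0) andbF.
Qed.

(** A root z that is not on the unit circle is the Salem root or its inverse, so
    its trace is the value y determined by that root. In the cyclotomic case
    there is no such z and y is an arbitrary number above 2. *)
Lemma root_trace {R : realType} (T : {poly int}) :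
    cyclotomic_poly R T \/ salem_poly R T ->
  exists2 y : R, 2 < y & forall z, root (toC R T) z -> z^-1 != z ->
    exists2 r : R, z + z^-1 = r%:C%C & -2 < r < 2 \/ r = y.
Proof.
move=> hT; have := hT; case=> [[_ T_circ]|[T_monic T_rec [x [x1 _ _ x_uniq]] _]].
  exists 3; first by lra.
  move=> z /T_circ z1 zV; have [r zr r_itv] := norm1_trace z z1 zV.
  by exists r => //; left.
have x0 : 0 < x by rewrite (lt_trans ltr01).
have xE : x%:C%C + (x%:C%C)^-1 = (x + x^-1)%:C%C :> R[i].
  by rewrite rmorphD fmorphV.
exists (x + x^-1).
  rewrite -subr_gt0 (_ : _ - _ = (x - 1) ^+ 2 / x); last by field; rewrite gt_eqF.
  by rewrite divr_gt0// exprn_gt0// subr_gt0.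
move=> z Tz zV; have [z0 TzV] := root_toC_inv T z hT Tz.
case: (real_ltgtP (normr_real z) (real1 _)) => z1.
- exists (x + x^-1); last by right.
  rewrite -xE -[z in LHS]invrK (x_uniq z^-1)//.
    by rewrite invrK addrC.
  by rewrite normfV invf_gt1// normr_gt0.
- by exists (x + x^-1); [rewrite -xE (x_uniq z) | right].
- by have [r zr r_itv] := norm1_trace z z1 zV; exists r => //; left.
Qed.

Theorem theorem1p1 (R : realType) (m : nat) (T : {poly int})
    (hm : (4 <= m)%N) (hdeg : size T = m.+1)
    (hsimple : simple_roots (toC R T))
    (hroot1 : ~~ root (toC R T) 1) (hrootN1 : ~~ root (toC R T) (-1))
    (hT : cyclotomic_poly R T \/ salem_poly R T) :
  exists P : {poly int},
    [/\ P \is monic, size P = m.+1, expansive (toC R P)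
      & ('X - 1) * T = 'X * P - reciprocal P].
Proof.
have T_monic : T \is monic by case: hT => -[].
have [rs rs_uniq rsE] := simple_monic_factor T T_monic hsimple.
have rsP z : (z \in rs) = root (toC R T) z by rewrite rsE root_prod_XsubC.
have zV z : root (toC R T) z -> z^-1 != z.
  move=> Tz; have [z0 _] := root_toC_inv T z hT Tz.
  apply: contraTneq Tz => zV; have : z ^+ 2 == 1 by rewrite expr2 -{1}zV mulVf.
  by rewrite sqrf_eq1 => /orP[]/eqP->.
have [z z_rs|xs [xs_uniq xsE xs_rs]] := prod_inverse_pairs rs rs_uniq.
  move: z_rs; rewrite rsP => Tz; have [z0 TzV] := root_toC_inv T z hT Tz.
  by rewrite z0 rsP TzV zV.
have [y y2 traceP] := root_trace T hT.
have xsP x : x \in xs ->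
    exists2 r : R, x = r%:C%C & -2 < r < 2 \/ r = y.
  by move=> /xs_rs[z]; rewrite rsP => Tz ->; apply: traceP => //; exact: zV.
pose ys := sort <=%R [seq complex.Re x | x <- xs].
have xs_ys : xs = [seq r%:C%C | r <- [seq complex.Re x | x <- xs]].
  rewrite -map_comp -[LHS]map_id; apply/eq_in_map => x /xsP[r -> _] //.
have ys_size : size ys = size xs by rewrite size_sort size_map.
have ysP r : r \in ys -> -2 < r < 2 \/ r = y.
  by rewrite mem_sort => /mapP[x /xsP[r' -> r'_itv] ->].
have ys_sorted : sorted <%R ys.
  rewrite sort_lt_sorted map_inj_in_uniq// => x x'.
  by move=> /xsP[r -> _] /xsP[r' -> _] /= ->.
have TE : toC R T = \prod_(r <- ys) quad r%:C%C.
  by rewrite rsE xsE xs_ys big_map; apply: perm_big; rewrite perm_sym perm_sort.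
have m_size : m = (size ys).*2.
  have := size_prod_quad xs; rewrite -xsE -rsE size_toC hdeg ys_size.
  by move=> [].
have ys_gt1 : (1 < size ys)%N by move: hm; rewrite m_size; lia.
have ys_n : (size ys).-1.+1 = size ys by rewrite prednK// ltnW.
pose x j := nth 0 ys j.
have x_lt i j : (i < j < size ys)%N -> x i < x j.
  move=> /andP[ij j_lt]; apply: (sorted_ltn_nth lt_trans) => //.
  by rewrite inE (ltn_trans ij).
rewrite m_size -ys_n; apply: (@expansive_of_traces R _ T x).
- by rewrite TE (big_nth 0) big_mkord ys_n.
- by move=> j jn; apply: x_lt; rewrite ltnSn/= -ys_n ltnS.
- have /ysP[/andP[] //|->] : x 0 \in ys by rewrite mem_nth// ltnW.
  by rewrite (lt_trans _ y2)//; lra.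
(* Only the largest trace can be y: if x j = y with j below the last index, the
   last trace would be greater than y, hence neither y nor below 2. *)
- move=> j jn; have j_lt : (j < size ys)%N by rewrite -ys_n ltnS ltnW.
  have /ysP[/andP[] //|xj] : x j \in ys by rewrite mem_nth.
  have xj_lt : x j < x (size ys).-1 by apply: x_lt; rewrite jn -ys_n /=.
  have /ysP[/andP[_ H]|H] : x (size ys).-1 \in ys by rewrite mem_nth// -ys_n.
    by move: xj_lt H y2; rewrite xj; lra.
  by move: xj_lt; rewrite xj H ltxx.
Qed.
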